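(* Let $q$ and $r$ be integers such that $0\leq r<q$, and for each $n$ let $m=\lfloor n/2\rfloor$. Then \[\lim_{n\rightarrow\infty}\frac{\sum_{j=0}^{\lfloor m/q\rfloor} d(n,r+jq)}{D(n)}=\lim_{n\rightarrow\infty}\frac{d(n,r)+d(n,q+r)+\cdots+d(n,q\lfloor (m-r)/q\rfloor+r)}{D(n)}=\frac{1}{q}.\]
   Context: A derangement is a permutation with no fixed points (no cycles of length 1). $D(n)$ denotes the number of derangements of length $n$ (i.e. of $\{1,\dots,n\}$), and $d(n,k)$ denotes the number of derangements of length $n$ with exactly $k$ cycles; in particular $d(n,k)=0$ for $k>\lfloor n/2\rfloor$, so the two numerators are equal. *)

(* Defs.v *)
From HB Require Import structures.
From mathcomp Require Import all_boot all_order all_algebra all_fingroup.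

Set Implicit Arguments.
Unset Strict Implicit.
Unset Printing Implicit Defensive.

Local Open Scope nat_scope.

Definition derangements (n : nat) : {set 'S_n} :=
  [set s : 'S_n | [forall i : 'I_n, s i != i]].

Definition D (n : nat) : nat := #|derangements n|.

Definition d (n k : nat) : nat :=
  #|[set s in derangements n | #|porbits s| == k]|.

(* floor((m - r) / q) + 1 with m = floor(n / 2), i.e. the number of indices j
   with 0 <= j <= floor((m - r) / q).  The difference and the floor are taken
   in the integers: for r < q the floor is at least -1, so the absolute value
   only converts to nat, and the index range is empty exactly when m < r. *)
Definition num_indices (n q r : nat) : nat :=
  absz (((n./2%:Z - r%:Z)%R %/ q%:Z)%Z + 1)%R.

(* Main.v *)
(* Inclusion-exclusion over the fixed points writes the number of derangements
   of n points with c cycles modulo q as the alternating sum, over the subsets A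
   of the n points, of the number of permutations supported in A with c cycles
   modulo q. For the latter, adding a point to A (multiplying by a transposition)
   replaces the distribution w of the number of cycles modulo q, for |A| = m, by
   (w(c) + m w(c+1)) / (m+1). This averaging fixes the uniform distribution and,
   by a Poincare inequality on the cycle Z/q, multiplies the squared distance to
   it by at most 1 - m / (q (m+1))^2. The product of these factors tends to 0, at
   a rate independent of n. Convolving with 1/k!, the number of derangements with
   r cycles modulo q is D(n)/q + o(n!), and D(n)/n! tends to 1/e > 0. *)

Require Import Defs.
From HB Require Import structures.
From mathcomp Require Import all_boot all_order all_algebra all_fingroup.
From mathcomp Require Import all_classical all_reals all_analysis.
From mathcomp Require Import ring lra zify.

Set Implicit Arguments.
Unset Strict Implicit.
Unset Printing Implicit Defensive.

Import Order.TTheory GRing.Theory Num.Theory.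
Import numFieldNormedType.Exports.
Local Open Scope ring_scope.

(** * Cycle counts when a point is added to the support *)

Lemma card_porbits1 (T : finType) : #|porbits (1 : {perm T})%g| = #|T|.
Proof.
have E x : porbit (1 : {perm T})%g x = [set x].
  apply/finset.setP=> y; rewrite inE; apply/porbitP/eqP=> [[i ->]|->].
    by rewrite expg1n perm1.
  by exists 0%N; rewrite expg1n perm1.
rewrite /porbits card_imset // => x y; rewrite !E => /finset.set1_inj //.
Qed.

Lemma porbits_gt0 (T : finType) (s : {perm T}) (x : T) : (0 < #|porbits s|)%N.
Proof. by apply/card_gt0P; exists (porbit s x); apply: imset_f. Qed.

(** A permutation supported in [a |: A] is determined by the preimage [b] of [a] and by the
    permutation of [A] left after removing the factor [tperm a b], which is trivial when [b = a]. *)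
Lemma perm_on_setU1E (T : finType) (A : {set T}) (a b : T) (s : {perm T}) :
  a \notin A -> b \in a |: A ->
  perm_on (a |: A) (tperm a b * s)%g && ((tperm a b * s)^-1%g a == b)
  = perm_on A s.
Proof.
move=> aA bA; apply/andP/idP => [[on_s /eqP sb]|on_s].
  have sa : s a = a.
    by have := permKV (tperm a b * s)%g a; rewrite sb permM tpermR.
  apply/fintype.subsetP=> x; rewrite unfold_in => sx.
  have xa : x != a by apply: contraNneq sx => ->; rewrite sa.
  apply: contraNT sx => xA.
  have xaA : x \notin a |: A by rewrite !inE negb_or xa.
  have xb : b != x by apply: contraNneq xaA => <-.
  by rewrite -{2}(out_perm on_s xaA) permM tpermD // eq_sym.
have sa := out_perm on_s aA; split.
  apply: perm_onM.
    apply: fintype.subset_trans (tperm_on a b) _.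
    by apply/fintype.subsetP=> x /set2P[]->; rewrite // !inE eqxx.
  by apply: fintype.subset_trans on_s (finset.subsetUr _ _).
by rewrite -(inj_eq (@perm_inj _ (tperm a b * s)%g)) permKV permM tpermR sa.
Qed.

(** [porbits] covers all of [T], so each point outside [A] counts as a cycle of its own. *)
Definition cycle_sum (R : nmodType) (T : finType) (A : {set T}) (F : nat -> R) :=
  \sum_(s : {perm T} | perm_on A s) F #|porbits s|.

Lemma cycle_sum0 (R : nmodType) (T : finType) (F : nat -> R) :
  cycle_sum (@finset.set0 T) F = F #|T|.
Proof.
rewrite /cycle_sum (big_pred1 1%g) ?card_porbits1 // => s /=.
apply/idP/eqP => [h|->]; last exact: perm_on1.
by apply: (perm_on_id h); rewrite cards0.
Qed.

(** Sort by the preimage [b] of [a]. For [b = a] the cycles are unchanged; each of the other [#|A|]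
    choices merges the fixed point [a] into the cycle of [b], which costs one cycle. *)
Lemma cycle_sumU1 (R : nmodType) (T : finType) (A : {set T}) (a : T)
    (F : nat -> R) : a \notin A ->
  cycle_sum (a |: A) F =
  cycle_sum A F + cycle_sum A (fun k => F k.-1) *+ #|A|.
Proof.
move=> aA; rewrite /cycle_sum.
rewrite (partition_big (fun s : {perm T} => (s^-1)%g a) (mem (a |: A))) /=; last first.
  by move=> s on_s; rewrite (perm_closed _ (perm_onV on_s)) !inE eqxx.
rewrite (eq_bigr (fun b => \sum_(s : {perm T} | perm_on A s)
    F #|porbits (tperm a b * s)%g|)); last first.
  move=> b bA; rewrite (reindex_inj (mulgI (tperm a b))) /=.
  by apply: eq_bigl => s; rewrite perm_on_setU1E.
rewrite (big_setU1 _ aA) /=; congr +%R.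
  by apply: eq_bigr => s _; rewrite tperm1 mul1g.
rewrite -sumr_const; apply: eq_bigr => b bA; apply: eq_bigr => s on_s.
have ab : a != b by apply: contraNneq aA => ->.
have := porbits_mul_tperm s a b; rewrite ab /= => e.
have nab : a \notin porbit s b.
  rewrite -porbit_sym; apply/porbitP => -[i ba].
  have : perm_on A (s ^+ i)%g.
    by elim: i {ba} => [|i IH]; rewrite ?perm_on1 // expgS perm_onM.
  by move/out_perm => /(_ a aA); rewrite -ba => /eqP; rewrite eq_sym (negPf ab).
by congr F; move: e; rewrite nab; lia.
Qed.

(** * Inclusion-exclusion over the fixed points *)

(** Expand the indicator of a derangement, the product over [i] of [1 - (s i == i)]. [A] collects
    the points where the term 1 is chosen; the other factors vanish unless [s] fixes everything
    outside [A]. *)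
Lemma derangement_cycle_sum (R : comNzRingType) (n : nat) (F : nat -> R) :
  \sum_(s in derangements n) F #|porbits s| =
  \sum_(A : {set 'I_n}) (-1) ^+ (n - #|A|) * cycle_sum A F.
Proof.
rewrite big_mkcond /=.
rewrite (eq_bigr (fun s : 'S_n => \sum_(A : {set 'I_n})
   (-1) ^+ (n - #|A|) * (if perm_on A s then F #|porbits s| else 0))).
  rewrite exchange_big /=; apply: eq_bigr => A _.
  by rewrite -big_distrr /= -big_mkcond.
move=> s _.
have -> : (if s \in derangements n then F #|porbits s| else 0) =
   (\prod_(i < n) (1 + - (s i == i)%:R)) * F #|porbits s|.
  rewrite inE; case: ifP => [/forallP h|/negbT].
    by rewrite big1 ?mul1r // => i _; rewrite (negPf (h i)) oppr0 addr0.
  by rewrite negb_forall => /existsP[i /negPn si];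
     rewrite (bigD1 i) //= si subrr !mul0r.
rewrite bigA_distr big_distrl /=; apply: eq_bigr => A _.
have -> : (n - #|A| = #|~: A|)%N by rewrite [RHS]cardsCs finset.setCK card_ord.
rewrite (bigID (mem A)) /= big1 ?mul1r; last by move=> i ->.
rewrite (eq_bigr (fun i => - (s i == i)%:R)); last by move=> i /negPf ->.
case: ifP => [on_s|/negbT].
  congr (_ * _); rewrite (eq_bigr (fun _ => -1)); last first.
    by move=> i iA; rewrite (out_perm on_s iA) eqxx.
  by rewrite prodr_const; congr (_ ^+ _); apply: eq_card => i; rewrite !inE.
case/fintype.subsetPn => i; rewrite unfold_in => si iA.
by rewrite (bigD1 i) //= (negPf si) oppr0 !mul0r mulr0.
Qed.

(** * Sums of [d] as counts in a residue class *)

Lemma derangement_porbits_leq (n : nat) (s : 'S_n) :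
  s \in derangements n -> (#|porbits s| <= n./2)%N.
Proof.
rewrite inE => /forallP ns.
rewrite -(half_bit_double #|porbits s| false) add0n half_leq // -muln2.
have nE : n = (\sum_(x < n) 1)%N by rewrite sum1_card card_ord.
rewrite [leqRHS]nE (partition_big (porbit s) (mem (porbits s))) /=;
  last by move=> x _; apply: imset_f.
rewrite -sum_nat_const; apply: leq_sum => B /imsetP[x _ ->].
rewrite sum1_card; have <- : #|[set x; s x]| = 2%N by rewrite cards2 eq_sym ns.
apply: subset_leq_card; apply/fintype.subsetP => y /set2P[]->; rewrite unfold_in.
  exact: eqxx.
by rewrite [X in is_true X]eq_porbit_mem; apply: (mem_porbit s 1).
Qed.

(** Any [J] past the largest possible cycle count will do, so both index ranges of the theorem
    reduce to the same count. *)
Lemma sum_d_mod (n q r J : nat) : (r < q)%N -> (n./2 < q * J + r)%N ->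
  (\sum_(0 <= j < J) d n (q * j + r))%N =
  #|[set s in derangements n | #|porbits s| == r %[mod q]]|.
Proof.
move=> rq nJ; rewrite big_mkord -sum1_card.
transitivity (\sum_(j < J) \sum_(s in derangements n)
    (#|porbits s| == q * j + r))%N.
  apply: eq_bigr => j _; rewrite /d -sum1_card -big_mkcondr /=.
  by apply: eq_bigl => s; rewrite inE.
rewrite exchange_big /= [RHS](eq_bigl (fun s => (s \in derangements n) &&
  (#|porbits s| == r %[mod q]))); last by move=> s; rewrite inE.
rewrite [RHS]big_mkcondr /=; apply: eq_bigr => s der_s.
have kn := leq_ltn_trans (derangement_porbits_leq der_s) nJ.
rewrite (modn_small rq); case: eqP => [kr|nkr]; last first.
  apply: big1 => j _; case: eqP => // kj; case: nkr.
  by rewrite kj mulnC modnMDl modn_small.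
have jJ : (#|porbits s| %/ q < J)%N.
  by move: kn; rewrite {1}(divn_eq #|porbits s| q) kr ltn_add2r mulnC
    ltn_pmul2l ?(leq_ltn_trans _ rq).
rewrite (bigD1 (Ordinal jJ)) //= {1}(divn_eq #|porbits s| q) kr mulnC eqxx.
rewrite big1 // => j /eqP nj; case: eqP => // kj; case: nj; apply: val_inj => /=.
by rewrite kj mulnC divnMDl ?divn_small ?addn0 ?(leq_ltn_trans _ rq).
Qed.

(** * Deviation of the cycle count modulo q from uniformity *)

(* [cycle_sum_mod] identifies this as the deviation from 1/q of the proportion,
   among the m! permutations of n points moving only points of a fixed m-set,
   of those whose number of cycles (fixed points included) is c modulo q. *)
Fixpoint excess (R : fieldType) (q n m c : nat) : R :=
  if m is m'.+1
  then (excess R q n m' c + m'%:R * excess R q n m' c.+1) / m'.+1%:R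
  else (n == c %[mod q])%:R - q%:R^-1.

Lemma cycle_sum_mod (R : numFieldType) (T : finType) (A : {set T}) (q c : nat) :
  cycle_sum A (fun k => (k == c %[mod q])%:R) =
  (#|A|)`!%:R * (q%:R^-1 + excess R q #|T| #|A| c).
Proof.
move: {2}#|A| (erefl #|A|) => m; elim: m A c => [|m IH] A c Am.
  by rewrite (cards0_eq Am) cycle_sum0 cards0 fact0 mul1r /= addrC subrK.
have [a aA] : exists a, a \in A by apply/card_gt0P; rewrite Am.
have Bm : #|A :\ a| = m by move: (cardsD1 a A); rewrite aA Am => -[].
rewrite -(finset.setD1K aA) cycle_sumU1 ?finset.setD11 // finset.setD1K // Bm IH // Bm.
(* The point [a] guarantees a cycle, so [k.-1] is a true predecessor and the congruence can be
   shifted to [c.+1]. *)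
have -> : cycle_sum (A :\ a) (fun k => (k.-1 == c %[mod q])%:R) =
    cycle_sum (A :\ a) (fun k => (k == c.+1 %[mod q])%:R) :> R.
  apply: eq_bigr => s _; have := porbits_gt0 s a.
  case: #|porbits s| => // k _ /=.
  by rewrite -[k.+1]addn1 -[c.+1]addn1 eqn_modDr.
rewrite IH // Bm Am /= factS natrM -natr1.
by move: q%:R^-1 => u; field; rewrite natr1 pnatr_eq0.
Qed.

Lemma sum_set_card (R : pzRingType) (T : finType) (g : nat -> R) :
  \sum_(A : {set T}) g #|A| = \sum_(m < #|T|.+1) 'C(#|T|, m)%:R * g m.
Proof.
rewrite (partition_big (fun A : {set T} => inord #|A| : 'I_#|T|.+1) predT) //=.
apply: eq_bigr => m _; rewrite -card_draws.
have -> : #|[set A : {set T} | #|A| == m]|%:R =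
    \sum_(A in [set A : {set T} | #|A| == m]) 1 :> R by rewrite sumr_const.
rewrite big_distrl /=.
have E (A : {set T}) : (inord #|A| == m) = (A \in [set A : {set T} | #|A| == m]).
  by rewrite inE -val_eqE /= inordK // ltnS max_card.
by apply: eq_big => // A; rewrite E inE => /eqP ->; rewrite mul1r.
Qed.

(** Group the subsets by size [m]; ['C(n, m) * m! / n! = 1 / (n - m)!] turns the sum into a
    convolution with the coefficients of exp(-x). *)
Lemma derangement_mod_sum (R : numFieldType) (n q r : nat) :
  #|[set s in derangements n | #|porbits s| == r %[mod q]]|%:R / n`!%:R =
  \sum_(m < n.+1) (-1) ^+ (n - m) / (n - m)`!%:R * (q%:R^-1 + excess R q n m r) :> R.
Proof.
rewrite -sum1_card natr_sum.
rewrite (eq_bigl (fun s => (s \in derangements n) && (#|porbits s| == r %[mod q])));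
  last by move=> s; rewrite inE.
rewrite big_mkcondr /= (eq_bigr (fun s : 'S_n => (#|porbits s| == r %[mod q])%:R));
  last by move=> s _; case: (_ == _).
rewrite (derangement_cycle_sum n (fun k => (k == r %[mod q])%:R)).
rewrite (eq_bigr (fun A : {set 'I_n} => (-1) ^+ (n - #|A|) *
   ((#|A|)`!%:R * (q%:R^-1 + excess R q n #|A| r)))); last first.
  by move=> A _; rewrite cycle_sum_mod card_ord.
rewrite (sum_set_card _ (fun m =>
  (-1) ^+ (n - m) * (m`!%:R * (q%:R^-1 + excess R q n m r)))).
rewrite card_ord big_distrl /=; apply: eq_bigr => m _.
have mn : (m <= n)%N by rewrite -ltnS.
rewrite -(bin_fact mn) !natrM; move: (q%:R^-1 + _) => u; field.
by rewrite !pnatr_eq0 -!lt0n bin_gt0 mn !fact_gt0.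
Qed.

Lemma derangement_sum (R : numFieldType) (n : nat) :
  (D n)%:R / n`!%:R = \sum_(m < n.+1) (-1) ^+ (n - m) / (n - m)`!%:R :> R.
Proof.
rewrite /D -sum1_card natr_sum (derangement_cycle_sum n (fun=> 1)).
rewrite (eq_bigr (fun A : {set 'I_n} => (-1) ^+ (n - #|A|) * (#|A|)`!%:R)); last first.
  by move=> A _; rewrite /cycle_sum sumr_const card_perm.
rewrite (sum_set_card _ (fun m => (-1) ^+ (n - m) * m`!%:R)).
rewrite card_ord big_distrl /=; apply: eq_bigr => m _.
have mn : (m <= n)%N by rewrite -ltnS.
rewrite -(bin_fact mn) !natrM; field.
by rewrite !pnatr_eq0 -!lt0n bin_gt0 mn !fact_gt0.
Qed.

(** * Decay of the squared deviation *)

(** Lagrange's identity against a constant sequence: it yields Cauchy-Schwarz, and for a mean-zero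
    function it expresses the sum of squares through pairwise differences. *)
Lemma sum_sqr_diff (R : comNzRingType) (I : Type) (s : seq I) (a : I -> R) :
  \sum_(i <- s) \sum_(j <- s) (a i - a j) ^+ 2 =
  2 * ((size s)%:R * (\sum_(i <- s) a i ^+ 2) - (\sum_(i <- s) a i) ^+ 2).
Proof.
have cst (c : R) : \sum_(i <- s) c = (size s)%:R * c.
  by rewrite big_const_seq count_predT iter_addr_0 mulr_natl.
rewrite (eq_bigr (fun i => (size s)%:R * a i ^+ 2 + (\sum_(j <- s) a j ^+ 2) +
    a i * (- 2 * \sum_(j <- s) a j))); last first.
  move=> i _; rewrite -cst mulrA big_distrr -!big_split /=.
  by apply: eq_bigr => j _; ring.
by rewrite !big_split /= cst -big_distrr -big_distrl /=; ring.
Qed.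

Lemma sqr_sum_le (R : realDomainType) (I : Type) (s : seq I) (a : I -> R) :
  (\sum_(i <- s) a i) ^+ 2 <= (size s)%:R * \sum_(i <- s) a i ^+ 2.
Proof.
rewrite -subr_ge0 -(pmulr_rge0 _ (ltr0n R 2)) -sum_sqr_diff.
by apply: sumr_ge0 => i _; apply: sumr_ge0 => j _; apply: sqr_ge0.
Qed.

(* The spectral gap that makes [excess] decay. *)
Lemma poincare_cycle (R : realDomainType) (q : nat) (f : nat -> R) :
  \sum_(0 <= c < q) f c = 0 ->
  \sum_(0 <= c < q) f c ^+ 2 <= q%:R ^+ 2 * \sum_(0 <= c < q) (f c - f c.+1) ^+ 2.
Proof.
move=> f0; set E := \sum_(0 <= c < q) (f c - f c.+1) ^+ 2.
have [->|q0] := posnP q; first by rewrite big_geq // expr0n mul0r.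
have E0 : 0 <= E by apply: sumr_ge0 => c _; apply: sqr_ge0.
(* Telescope from [i] to [j], then apply Cauchy-Schwarz to at most [q] increments. *)
have le_diff i j : (i <= j < q)%N -> (f i - f j) ^+ 2 <= q%:R * E.
  case/andP=> ij jq.
  have -> : f i - f j = \sum_(i <= k < j) (f k - f k.+1).
    rewrite -[f i - f j]opprB -(telescope_sumr f ij) -sumrN.
    by apply: eq_bigr => k _; rewrite opprB.
  apply: le_trans (sqr_sum_le _ _) _; rewrite size_iota.
  apply: ler_pM => //; first by apply: sumr_ge0 => k _; apply: sqr_ge0.
    by rewrite ler_nat; lia.
  rewrite /E (big_cat_nat (leq0n i) (leq_trans ij (ltnW jq))) /=.
  rewrite (big_cat_nat ij (ltnW jq)) /= addrCA lerDl addr_ge0 //;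
    by apply: sumr_ge0 => k _; apply: sqr_ge0.
have := sum_sqr_diff (index_iota 0 q) f.
rewrite f0 size_iota subn0 expr0n /= subr0 => e.
have qE : \sum_(0 <= i < q) \sum_(0 <= j < q) (f i - f j) ^+ 2
    <= \sum_(0 <= i < q) \sum_(0 <= j < q) (q%:R * E).
  rewrite big_nat [leRHS]big_nat; apply: ler_sum => i /andP[_ iq].
  rewrite big_nat [leRHS]big_nat; apply: ler_sum => j /andP[_ jq].
  have [ij|ji] := leqP i j; first by rewrite le_diff // ij.
  by rewrite -sqrrN opprB le_diff // (ltnW ji).
have cst : \sum_(0 <= i < q) \sum_(0 <= j < q) (q%:R * E) = q%:R * (q%:R * (q%:R * E)).
  by rewrite !sumr_const_nat subn0 !mulr_natl.
rewrite e cst in qE.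
set G := \sum_(0 <= c < q) f c ^+ 2 in qE *.
have q1 : 0 < q%:R :> R by rewrite ltr0n.
rewrite -(ler_pM2l q1).
(* Summing over pairs gave [2 * q * G <= q ^ 3 * E]; nonnegativity of [G] allows dropping the 2. *)
have G0 : 0 <= q%:R * G.
  by apply: mulr_ge0 => //; apply: sumr_ge0 => c _; apply: sqr_ge0.
lra.
Qed.

Section Excess.
Variables (R : realFieldType) (q n : nat).
Hypothesis q0 : (0 < q)%N.
Let e := excess R q n.
Let G m := \sum_(0 <= c < q) e m c ^+ 2.

Let qN0 : q%:R != 0 :> R. Proof. by rewrite pnatr_eq0 -lt0n. Qed.

Lemma excess_addr m c : e m (c + q) = e m c.
Proof.
elim: m c => [|m IH] c; first by rewrite /e /= modnDr.
by rewrite /e /= -addSn -/e !IH.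
Qed.

Let sum_shift (f : nat -> R) : f q = f 0%N ->
  \sum_(0 <= c < q) f c.+1 = \sum_(0 <= c < q) f c.
Proof.
case: q q0 => // k _ fq.
by rewrite big_nat_recr //= [RHS]big_nat_recl //= fq addrC.
Qed.

Lemma sum_excess m : \sum_(0 <= c < q) e m c = 0.
Proof.
elim: m => [|m IH].
  have cst : \sum_(0 <= c < q) - q%:R^-1 = -1 :> R.
    by rewrite sumr_const_nat subn0 mulNrn -[_^-1 *+ _]mulr_natl divff.
  rewrite /e /= big_split /= cst.
  rewrite big_mkord (bigD1 (Ordinal (ltn_pmod n q0))) //= modn_mod eqxx.
  rewrite big1 ?addr0 ?subrr // => i /negP ni; case: eqP => // ei; case: ni.
  by apply/eqP/val_inj; rewrite /= ei modn_small.
rewrite /e /= -big_distrl big_split -big_distrr /= -/e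
  sum_shift ?IH ?mulr0 ?addr0 ?mul0r //.
by rewrite -[q]add0n excess_addr.
Qed.

Lemma sum_excess_sqr_le m :
  G m <= q%:R * \prod_(j < m) (1 - j%:R / (q%:R ^+ 2 * j.+1%:R ^+ 2)).
Proof.
have q1 : 0 < q%:R :> R by rewrite ltr0n.
elim: m => [|m IH].
  rewrite big_ord0 mulr1 -[leRHS]mulr_natl mulr1 /G.
  have -> : q%:R = \sum_(0 <= c < q) (1 : R) by rewrite sumr_const_nat subn0.
  apply: ler_sum => c _; rewrite /e /=.
  have i0 : 0 <= q%:R^-1 :> R by rewrite invr_ge0 ltW.
  have i1 : q%:R^-1 <= 1 :> R by rewrite invf_le1 // ler1n.
  by case: eqP => _ /=; nra.
have m1 : 0 < m.+1%:R :> R by rewrite ltr0n.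
(* Summed over a period, this is [(a + m b)^2 = (m + 1) (a^2 + m b^2) - m (a - b)^2], where [a] and
   [b] are consecutive values of [e m]. *)
have GS : G m.+1 = G m - m%:R / m.+1%:R ^+ 2 *
    \sum_(0 <= c < q) (e m c - e m c.+1) ^+ 2.
  rewrite -{1}[G m](@mulfK _ (m.+1%:R ^+ 2)) ?expf_neq0 ?gt_eqF //.
  rewrite -[m.+1%:R]natr1.
  have S : \sum_(0 <= c < q) e m c.+1 ^+ 2 = G m.
    by rewrite (sum_shift (f := fun c => e m c ^+ 2)) // -[q]add0n excess_addr.
  have -> : G m * (m%:R + 1) ^+ 2 = (m%:R + 1) * G m + (m%:R ^+ 2 + m%:R) *
     \sum_(0 <= c < q) e m c.+1 ^+ 2 by rewrite S; ring.
  rewrite mulrAC -mulrBl /G !big_distrr -sumrN -!big_split big_distrl /=.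
  apply: eq_bigr => c _; rewrite /e /= -/e -natr1; field.
  by rewrite natr1 gt_eqF.
have P := poincare_cycle (sum_excess m).
rewrite big_ord_recr /= mulrA.
apply: le_trans (_ : G m * (1 - m%:R / (q%:R ^+ 2 * m.+1%:R ^+ 2)) <= _).
  rewrite GS mulrBr mulr1 lerD2l lerN2.
  have -> : G m * (m%:R / (q%:R ^+ 2 * m.+1%:R ^+ 2)) = 
     m%:R / m.+1%:R ^+ 2 * (G m / q%:R ^+ 2).
    by field; rewrite qN0 addrC natr1 gt_eqF.
  apply: ler_wpM2l; first by rewrite divr_ge0 ?sqr_ge0.
  by rewrite ler_pdivrMr ?exprn_gt0 // mulrC.
apply: ler_wpM2r => //.
rewrite subr_ge0 ler_pdivrMr ?mulr_gt0 ?exprn_gt0 // mul1r -!natrX -natrM ler_nat.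
by nia.
Qed.

End Excess.

(** * Limits of the decay factors and of convolutions *)

Local Open Scope classical_set_scope.
Local Open Scope ring_scope.

Lemma decay_cvg0 (R : realType) (q : nat) : (0 < q)%N ->
  (fun m => \prod_(j < m) (1 - j%:R / (q%:R ^+ 2 * j.+1%:R ^+ 2)) : R)
    @ \oo --> (0 : R).
Proof.
move=> q0; set x := fun j : nat => j%:R / (q%:R ^+ 2 * j.+1%:R ^+ 2) : R.
have q1 : 0 < q%:R :> R by rewrite ltr0n.
have xge0 j : 0 <= x j by rewrite /x divr_ge0 // mulr_ge0 ?sqr_ge0.
have xle1 j : x j <= 1.
  rewrite /x ler_pdivrMr ?mulr_gt0 ?exprn_gt0 ?ltr0n // mul1r -!natrX -natrM ler_nat.
  by nia.
have P0 m : 0 <= \prod_(j < m) (1 - x j).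
  by apply: prodr_ge0 => j _; rewrite subr_ge0.
(* The product and the series move in opposite directions since
   (1 - x) (1 + S + x) <= 1 + S; the harmonic series then forces the product
   to 0. *)
have PS m : (\prod_(j < m) (1 - x j)) * (1 + series x m) <= 1.
  elim: m => [|m IH]; first by rewrite big_ord0 /series /= big_geq // addr0 mul1r.
  apply: le_trans IH.
  have -> : series x m.+1 = series x m + x m by rewrite /series /= big_nat_recr.
  rewrite big_ord_recr /= -mulrA; apply: ler_wpM2l; first exact: P0.
  have S0 : 0 <= series x m by apply: sumr_ge0 => j _; apply: xge0.
  have -> : (1 - x m) * (1 + (series x m + x m)) =
      1 + series x m - (x m * series x m + x m ^+ 2) by ring.
  by rewrite gerBl addr_ge0 ?mulr_ge0 ?sqr_ge0.
have S0 m : 0 <= series x m by apply: sumr_ge0 => j _; apply: xge0.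
(* The 4 comes from [j + 2 <= 2 (j + 1)]; the index is shifted because [x 0 = 0]. *)
have xharm j : harmonic j <= 4 * q%:R ^+ 2 * x j.+1.
  rewrite /x /harmonic /= -[leLHS]div1r.
  have -> : 4 * q%:R ^+ 2 * (j.+1%:R / (q%:R ^+ 2 * j.+2%:R ^+ 2)) =
      4 * j.+1%:R / j.+2%:R ^+ 2 :> R.
    by field; rewrite !gt_eqF // ?ltr0n // ltr_wpDl.
  rewrite ler_pdivlMr ?exprn_gt0 // mulrAC ler_pdivrMr // mul1r.
  by rewrite -!natrX -!natrM ler_nat; nia.
have Sy : series x @ \oo --> +oo.
  apply: nondecreasing_dvgn_lt.
    by apply: nondecreasing_series => j _ _; apply: xge0.
  move=> cx; apply: (@dvg_harmonic R).
  apply: (@series_le_cvg R _ ((4 * q%:R ^+ 2) *: (fun j => x j.+1))).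
  - by move=> j; apply: harmonic_ge0.
  - by move=> j; apply: mulr_ge0; rewrite ?mulr_ge0 ?sqr_ge0.
  - by move=> j; apply: xharm.
  apply: is_cvg_seriesZ.
  have -> : series (fun j => x j.+1) = [sequence series x n.+1]_n.
    apply/funext => n; rewrite /series /= [RHS]big_nat_recl //=.
    by rewrite {2}/x mul0r add0r.
  by move/cvg_ex: cx => [l cl]; apply/cvg_ex; exists l; rewrite cvg_shiftS.
apply/cvgr0Pnorm_le => e e0; near=> m.
rewrite ger0_norm ?P0 //.
have Sm : e^-1 <= series x m by near: m; move/cvgryPge: Sy; apply.
rewrite -[e]invrK -[leRHS]div1r ler_pdivlMr ?invr_gt0 //.
apply: le_trans (PS m); apply: ler_wpM2l; first exact: P0.
by apply: le_trans Sm _; rewrite lerDr.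
Unshelve. all: by end_near. Qed.

(** Cut at an [N] beyond which [u] is small: the tail is at most that bound times the sum of [a],
    and each of the first [N] terms tends to 0 with [a (n - m)]. *)
Lemma convolution_cvg0 (R : realType) (a u : R ^nat) :
  (forall n, 0 <= a n) -> (forall n, 0 <= u n) ->
  cvgn (series a) -> u @ \oo --> (0 : R) ->
  (fun n => \sum_(m < n.+1) a (n - m)%N * u m) @ \oo --> (0 : R).
Proof.
move=> a0 u0 ca cu; set A := limn (series a).
have A0 : 0 <= A by apply: limr_ge => //; apply: nearW => n; apply: sumr_ge0.
have leA n : series a n <= A.
  apply: nondecreasing_cvgn_le => //.
  by apply: nondecreasing_series => j _ _; apply: a0.
apply/cvgr0Pnorm_le => e e0.
(* Dividing by [A + 1] covers the case [A = 0]. *)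
have d0 : 0 < e / 2 / (A + 1) by rewrite !divr_gt0 // ltr_wpDl.
have [N _ uN] : \forall m \near \oo, `|u m| <= e / 2 / (A + 1).
  by move/cvgr0Pnorm_le : cu; apply.
have head : (fun n => \sum_(m < N) a (n - m)%N * u m) @ \oo --> (0 : R).
  rewrite [X in _ --> X](_ : _ = \sum_(m < N) (0 * u m)); last first.
    by rewrite big1 // => m _; rewrite mul0r.
  apply: cvg_big => [|m _]; first exact: add_continuous.
  apply: cvgMr_tmp.
  exact: (cvg_comp _ _ (@cvg_subnr m) (cvg_series_cvg_0 ca)).
near=> n.
have Nn : (N <= n.+1)%N by near: n; exists N => // k /= /leqW.
rewrite ger0_norm; last by apply: sumr_ge0 => m _; apply: mulr_ge0.
rewrite -(big_mkord predT (fun m => a (n - m)%N * u m)).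
rewrite (big_cat_nat (leq0n N) Nn) /= big_mkord [e]splitr lerD //.
  apply: le_trans (ler_norm _) _; near: n.
  by move/cvgr0Pnorm_le : head; apply; rewrite divr_gt0.
apply: (@le_trans _ _ (\sum_(N <= m < n.+1) a (n - m)%N * (e / 2 / (A + 1)))).
  rewrite big_nat [leRHS]big_nat; apply: ler_sum => m /andP[Nm _].
  by apply: ler_wpM2l => //; apply: le_trans (ler_norm _) _; apply: uN.
rewrite -big_distrl /=.
apply: (@le_trans _ _ (A * (e / 2 / (A + 1)))).
  apply: ler_wpM2r; first exact: ltW.
  apply: le_trans (leA n.+1).
  rewrite /series /= [leRHS]big_nat_rev /= add0n.
  rewrite [leRHS](big_cat_nat (leq0n N) Nn) /=.
  by rewrite lerDr sumr_ge0.
rewrite mulrCA; apply: ler_piMr; first by rewrite divr_ge0 // ltW.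
by rewrite ler_pdivrMr ?mul1r ?lerDl // ltr_wpDl.
Unshelve. all: by end_near. Qed.


(** * Limits of the derangement proportions *)

Lemma cvg_derangement_ratio (R : realType) :
  (fun n => (D n)%:R / n`!%:R : R) @ \oo --> expR (-1 : R).
Proof.
have -> : (fun n => (D n)%:R / n`!%:R : R) =
    [sequence series (exp_coeff (-1 : R)) n.+1]_n.
  apply/funext => n; rewrite derangement_sum /series /= big_nat_rev /= big_mkord.
  by apply: eq_bigr => m _; rewrite add0n subSS.
by rewrite cvg_shiftS; apply: is_cvg_series_exp_coeff.
Qed.

Lemma cvg_derangement_mod (R : realType) (q r : nat) : (r < q)%N ->
  (fun n => #|[set s in derangements n | #|porbits s| == r %[mod q]]|%:R /
    (D n)%:R : R) @ \oo --> (1 / q%:R : R).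
Proof.
move=> rq; have q0 : (0 < q)%N by apply: leq_ltn_trans rq.
set U := fun n => #|[set s in derangements n | #|porbits s| == r %[mod q]]|%:R : R.
pose P m : R := \prod_(j < m) (1 - j%:R / (q%:R ^+ 2 * j.+1%:R ^+ 2)).
have excess_le n m : `|excess R q n m r| <= Num.sqrt (q%:R * P m).
  rewrite -sqrtr_sqr; apply: ler_wsqrtr.
  apply: le_trans (sum_excess_sqr_le R n q0 m).
  rewrite big_mkord (bigD1 (Ordinal rq)) //= lerDl.
  by apply: sumr_ge0 => c _; apply: sqr_ge0.
have sqrtP0 : (fun m => Num.sqrt (q%:R * P m)) @ \oo --> (0 : R).
  have qP : (fun m => q%:R * P m) @ \oo --> (q%:R * 0 : R).
    by apply: cvgMl_tmp; apply: decay_cvg0.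
  rewrite mulr0 in qP; rewrite -[X in _ --> X](sqrtr0 R).
  exact: (cvg_comp _ _ qP (@sqrt_continuous R 0)).
(* Subtracting the uniform share leaves the convolution of [excess] with signed inverse factorials,
   bounded uniformly in [n]. *)
have diff0 : (fun n => U n / n`!%:R - (D n)%:R / n`!%:R / q%:R) @ \oo --> (0 : R).
  apply: norm_cvg0.
  apply: (@squeeze_cvgr _ _ _ _ (fun=> 0)
    (fun n => \sum_(m < n.+1) (n - m)`!%:R^-1 * Num.sqrt (q%:R * P m))).
  - apply: nearW => n; rewrite normr_ge0 /= /U derangement_mod_sum derangement_sum.
    rewrite big_distrl -sumrB /=.
    apply: le_trans (ler_norm_sum _ _ _) _; apply: ler_sum => m _.
    rewrite mulrDr addrAC subrr add0r !normrM normrX normrN1 expr1n mul1r.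
    by rewrite ger0_norm ?invr_ge0 //; apply: ler_wpM2l; rewrite ?invr_ge0.
  - exact: cvg_cst.
  apply: (@convolution_cvg0 R (fun k => k`!%:R^-1)
    (fun m => Num.sqrt (q%:R * P m))) => //.
  have -> : (fun n : nat => n`!%:R^-1 : R) = exp_coeff (1 : R).
    by apply/funext => n; rewrite exp_coeffE expr1n mulr1.
  exact: is_cvg_series_exp_coeff.
have e1 := expR_gt0 (-1 : R).
have cD := @cvg_derangement_ratio R.
rewrite div1r -[X in _ --> X]add0r -[X in _ --> X + _](mul0r (expR (-1))^-1).
apply: cvg_trans (_ : (fun n => (U n / n`!%:R - (D n)%:R / n`!%:R / q%:R) *
   ((D n)%:R / n`!%:R)^-1 + q%:R^-1) @ \oo --> _); last first.
  by apply: cvgD; [apply: cvgM => //; apply: cvgV => //; rewrite gt_eqF | apply: cvg_cst].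
(* The rewriting of the ratio needs [D n] nonzero, hence only holds eventually ([D 1 = 0]); the
   positive limit of [D n / n!] provides this. *)
apply: near_eq_cvg; near=> n.
have fN0 : n`!%:R != 0 :> R by rewrite pnatr_eq0 -lt0n fact_gt0.
have : 0 < (D n)%:R / n`!%:R :> R by near: n; apply: (cvgr_gt _ cD).
have [->|DN0 _] := eqVneq ((D n)%:R : R) 0; first by rewrite mul0r ltxx.
by field; rewrite DN0 fN0 pnatr_eq0 -lt0n q0.
Unshelve. all: by end_near. Qed.

Theorem theorem3p3 (R : realType) (q r : nat) (hrq : (r < q)%N) :
  ((fun n : nat =>
      (\sum_(0 <= j < (n./2 %/ q).+1) d n (r + j * q))%N%:R / (D n)%:R : R)
     @ \oo --> (1 / q%:R : R))
  /\
  ((fun n : nat =>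
      (\sum_(0 <= j < num_indices n q r) d n (q * j + r))%N%:R / (D n)%:R : R)
     @ \oo --> (1 / q%:R : R)).
Proof.
have q0 : (0 < q)%N by apply: leq_ltn_trans hrq.
split; apply: cvg_trans (@cvg_derangement_mod R q r hrq); apply: near_eq_cvg;
  apply: nearW => n; congr (_%:R / _).
  rewrite -(@sum_d_mod n q r (n./2 %/ q).+1) //.
    by apply: eq_bigr => j _; rewrite addnC mulnC.
  by rewrite mulnC (leq_trans (ltn_ceil _ q0)) ?leq_addr.
rewrite -(@sum_d_mod n q r (num_indices n q r)) // /num_indices.
(* With [n./2 - r = k q + l] and [0 <= l < q], one gets [n./2 < q (k + 1) + r]; as [r < q] forces
   [k + 1 >= 0], [absz] leaves [k + 1] unchanged. *)
have := divz_eq (n./2%:Z - r%:Z)%R q%:Z.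
have := ltz_pmod (n./2%:Z - r%:Z)%R (_ : 0 < q%:Z); rewrite ltz_nat => /(_ q0).
set k := (_ %/ _)%Z; set l := (_ %% _)%Z => lq e.
have k0 : 0 <= k + 1.
  by nia.
nia.
Qed.
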